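(* Let $s\ge2r\ge2$ be integers, let $x=(i,c)\le y=(j,d)$ be elements of the trapezoidal poset $T_{r,s}$, and put $$\ell=i-j,\qquad u=d-c,\qquad \delta=s-i-c.$$ For the interval $[x,y]$ of $T_{r,s}$ with the induced rank $\rho_{x,y}(z)=\rho(z)-\rho(x)$, where $\rho(i,c)=c-i$, one has $$\mathbb{H}_{[x,y],\rho_{x,y}}(q,t)=\Phi_{\ell,u}^{\delta}(t,q).$$ In particular, $$\mathbb{H}_{[x,y],\rho_{x,y}}(1,1)=\binom{\ell+u}{\ell}-\binom{\ell+u}{\ell+\delta+1}.$$ Thus the numerator of $[x,y]$ depends only on the displacement $(\ell,u)$ and the boundary slack $\delta$.
   Context: $q$-Zeta numerator: let $P$ be a finite graded poset with a unique maximum and rank function $\rho:P\to\{0,\dots,H\}$, where $H$ is the maximal rank. For $m\ge 0$ put $A_m(P,\rho;q)=\sum_{x_1\le\cdots\le x_m}q^{\rho(x_1)+\cdots+\rho(x_m)}$ (sum over weak chains in $P$; $A_0=1$). The numerator $\mathbb{H}_{P,\rho}(q,t)$ is the polynomial determined by $\sum_{m\ge 0}A_m(P,\rho;q)t^m=\mathbb{H}_{P,\rho}(q,t)/\prod_{a=0}^{H}(1-q^at)$. Trapezoidal poset: $T_{r,s}=\{(i,c):1\le i\le r,\ i\le c\le s-i\}$, ordered by $(i,c)\le(j,d)\iff i\ge j$ and $c\le d$. Gaussian binomials: for integers $N,k$, $\genfrac{[}{]}{0pt}{}{N}{k}_q=\prod_{v=1}^{k}\frac{1-q^{N-k+v}}{1-q^v}$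 if $0\le k\le N$, and $0$ otherwise (including when $N<0$). One-boundary polynomial: for integers $a,b,e\ge0$ with $b\le a+e$, $$\Phi_{a,b}^{e}(X,q)=\sum_{\nu\ge0}X^{\nu}q^{\nu^2}\left(\genfrac{[}{]}{0pt}{}{a}{\nu}_q\genfrac{[}{]}{0pt}{}{b}{\nu}_q-q^{e}\genfrac{[}{]}{0pt}{}{b-e+1}{\nu+1}_q\genfrac{[}{]}{0pt}{}{a+e-1}{\nu-1}_q\right).$$ *)

(* Defs.v *)
From HB Require Import structures.
From mathcomp Require Import all_boot all_order all_algebra.
From mathcomp Require Import ring.

Set Implicit Arguments.
Unset Strict Implicit.
Unset Printing Implicit Defensive.

Import Order.TTheory GRing.Theory Num.Theory.
Local Open Scope ring_scope.

(* Throughout, q is the variable 'X of {poly rat}, and polynomials in q and t *)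
(* are elements of {poly {poly rat}}, whose outer variable 'X is t.           *)

Section QZeta.
Variables (d : Order.disp_t) (P : finPOrderType d) (rho : P -> nat).

Definition weak_chain (m : nat) (c : m.-tuple P) : bool := sorted <=%O c.

Definition qzeta (m : nat) : {poly rat} :=
  \sum_(c : m.-tuple P | weak_chain c) 'X^(\sum_(z <- c) rho z).

Definition max_rank : nat := \max_(z : P) rho z.

Definition qzeta_denominator : {poly {poly rat}} :=
  \prod_(0 <= a < max_rank.+1) (1 - 'X^a *: 'X).

(* The identity N = qzeta_denominator * \sum_m (qzeta m) t^m of formal power  *)
(* series in t, coefficient by coefficient.  The denominator has constant     *)
(* term 1, so this is the same as N / qzeta_denominator = \sum_m (qzeta m) t^m *)
(* and at most one N satisfies it.                                            *)
Definition is_qzeta_numerator (N : {poly {poly rat}}) : Prop :=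
  forall m : nat,
    N`_m = \sum_(k < m.+1) qzeta_denominator`_k * qzeta (m - k)%N.

End QZeta.

Section Interval.
Variables (d : Order.disp_t) (T : finPOrderType d) (x y : T).

Record poset_interval := PosetInterval
  { interval_val :> T; _ : (x <= interval_val <= y)%O }.

HB.instance Definition _ := [isSub for interval_val].
HB.instance Definition _ := [Finite of poset_interval by <:].
HB.instance Definition _ := [SubChoice_isSubPOrder of poset_interval by <: with d].

Definition interval_rank (rho : T -> nat) (z : poset_interval) : nat :=
  (rho z - rho x)%N.

End Interval.

Definition in_trapezoid (r s : nat) (p : 'I_r.+1 * 'I_s.+1) : bool :=
  [&& (1 <= p.1)%N, (p.1 <= r)%N, (p.1 <= p.2)%N & (p.2 <= s - p.1)%N].

Record trapezoid (r s : nat) := Trapezoid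
  { trap_val : 'I_r.+1 * 'I_s.+1; _ : in_trapezoid trap_val }.

HB.instance Definition _ r s := [isSub for @trap_val r s].
HB.instance Definition _ r s := [Finite of trapezoid r s by <:].

Section Trapezoid.
Variables r s : nat.
Implicit Types z w : trapezoid r s.

(* The element (i, c) has trap_row i and trap_col c. *)
Definition trap_row z : nat := (trap_val z).1.
Definition trap_col z : nat := (trap_val z).2.

Definition trap_le z w : bool :=
  (trap_row w <= trap_row z)%N && (trap_col z <= trap_col w)%N.

Lemma trap_le_refl : reflexive trap_le.
Proof. by move=> z; rewrite /trap_le !leqnn. Qed.

Lemma trap_le_anti : antisymmetric trap_le.
Proof.
move=> z w; rewrite /trap_le => /andP[/andP[h1 h2] /andP[h3 h4]].
apply/val_inj; rewrite /= [LHS]surjective_pairing [RHS]surjective_pairing.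
by congr pair; apply/val_inj/eqP; rewrite eqn_leq /=; apply/andP.
Qed.

Lemma trap_le_trans : transitive trap_le.
Proof.
move=> b a c /andP[h1 h2] /andP[h3 h4].
by rewrite /trap_le (leq_trans h3 h1) (leq_trans h2 h4).
Qed.

HB.instance Definition _ :=
  Order.Le_isPOrder.Build (Order.Disp tt tt) (trapezoid r s)
    trap_le_refl trap_le_anti trap_le_trans.

Definition trap_rank z : nat := (trap_col z - trap_row z)%N.

End Trapezoid.

Definition gauss_num (n k : nat) : {poly rat} :=
  \prod_(1 <= v < k.+1) (1 - 'X^(n + v)).
Definition gauss_den (k : nat) : {poly rat} :=
  \prod_(1 <= v < k.+1) (1 - 'X^v).

(* The polynomial division is exact: see gaussE. *)
Definition gauss (N k : int) : {poly rat} :=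
  if 0 <= k <= N then gauss_num `|N - k|%N `|k|%N %/ gauss_den `|k|%N else 0.

Lemma gauss_den_dvd (n k : nat) : gauss_den k %| gauss_num n k.
Proof.
have [m] := ubnP (n + k); elim: m n k => // m IH n [|k] lt_m.
  by rewrite /gauss_den /gauss_num !big_nil dvdpp.
have numS i j : gauss_num i j.+1 = gauss_num i j * (1 - 'X^(i + j.+1)).
  by rewrite /gauss_num big_nat_recr.
have denS : gauss_den k.+1 = gauss_den k * (1 - 'X^(k.+1)).
  by rewrite /gauss_den big_nat_recr.
have -> : gauss_num n k.+1 =
    gauss_num n k * (1 - 'X^n) + 'X^n * (gauss_num n k * (1 - 'X^(k.+1))).
  by rewrite numS exprD; ring.
have nz : 1 - 'X^(k.+1) != 0 :> {poly rat}.
  by rewrite -size_poly_eq0 -opprB size_polyN size_XnsubC.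
rewrite addnS in lt_m.
apply: dvdp_add; last by rewrite dvdp_mull // denS dvdp_mul2r // IH.
case: n lt_m => [|n] lt_m; first by rewrite expr0 subrr mulr0 dvdp0.
suff -> : gauss_num n.+1 k * (1 - 'X^(n.+1)) = gauss_num n k.+1.
  by apply: IH; rewrite addnS.
rewrite /gauss_num big_add1 [in RHS]big_add1 /= [in RHS]big_nat_recl // addn1 mulrC.
by congr (_ * _); apply: eq_bigr => v _; rewrite addSnnS.
Qed.

Lemma gaussE (n k : nat) :
  gauss (n + k)%N%:Z k%:Z * gauss_den k = gauss_num n k.
Proof.
rewrite /gauss lez_nat leq_addl /= PoszD addrK.
by rewrite divpK ?gauss_den_dvd.
Qed.

Definition Phi_term (a b e nu : nat) : {poly rat} :=
  'X^(nu ^ 2) *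
  (gauss a%:Z nu%:Z * gauss b%:Z nu%:Z
   - 'X^e * gauss (b%:Z - e%:Z + 1) (nu%:Z + 1)
          * gauss (a%:Z + e%:Z - 1) (nu%:Z - 1)).

(* The terms with b < nu vanish, see Phi_term_eq0. *)
Definition Phi (a b e : nat) : {poly {poly rat}} :=
  \sum_(0 <= nu < b.+1) Phi_term a b e nu *: 'X^nu.

Lemma Phi_term_eq0 (a b e nu : nat) : (b < nu)%N -> Phi_term a b e nu = 0.
Proof.
move=> lt_b; rewrite /Phi_term.
have g0 N k : N < k -> gauss N k = 0.
  by move=> lt_Nk; rewrite /gauss [k <= N]leNgt lt_Nk andbF.
rewrite (g0 b%:Z) ?ltz_nat // (g0 (b%:Z - e%:Z + 1)) ?mulr0 ?mul0r ?subrr ?mulr0 //.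
by rewrite ltrD2r (le_lt_trans _ (_ : b%:Z < nu%:Z)) ?ltz_nat // gerBl.
Qed.

(* Main.v *)
(* Removing the top element (a, b) of the region {(i, j) : i <= a, j <= b,
   j <= i + e} leaves the union of the regions with corners (a - 1, b) and
   (a, b - 1), whose intersection has corner (a - 1, b - 1). For the series F of
   weighted multichains this gives
     (1 - q^(a+b) t) F(a, b) = F(a-1, b) + F(a, b-1) - F(a-1, b-1),
   or just F(a, b-1) on the right when b = a + e. After multiplication by the
   denominators, the numerators obey
     N(a, b) = N(a-1, b) + N(a, b-1) - (1 - q^(a+b-1) t) N(a-1, b-1),
     N(a, a+e) = N(a, a+e-1),
   and Phi obeys the same rules by the q-Pascal identity. At q = t = 1 these
   become the recurrences of ballot numbers. *)
Require Import Defs.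
From HB Require Import structures.
From mathcomp Require Import all_boot all_order all_algebra.
From mathcomp Require Import zify ring.

Set Implicit Arguments.
Unset Strict Implicit.
Unset Printing Implicit Defensive.

Import Order.TTheory GRing.Theory Num.Theory.
Local Open Scope ring_scope.

(** * Identities for Gaussian binomials *)

Lemma gauss_small (N k : int) : N < k -> gauss N k = 0.
Proof. by move=> lt_Nk; rewrite /gauss [k <= N]leNgt lt_Nk andbF. Qed.

Lemma gauss_neg (N k : int) : k < 0 -> gauss N k = 0.
Proof. by move=> k_lt0; rewrite /gauss [0 <= k]leNgt k_lt0. Qed.

Lemma gauss_den_neq0 k : gauss_den k != 0.
Proof.
rewrite /gauss_den big_add1 prodf_seq_neq0; apply/allP => v _ /=.
by rewrite -size_poly_eq0 -opprB size_polyN size_XnsubC.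
Qed.

Lemma gauss_n0 (N : int) : 0 <= N -> gauss N 0 = 1.
Proof.
case: N => // n _; have := gaussE n 0.
by rewrite addn0 /gauss_den /gauss_num !big_nil mulr1.
Qed.

(** Puts a term of Pascal's rule over the common numerator [gauss_num n k]; for n = 0 both sides
    vanish. *)
Lemma gauss_predE (n k : nat) :
  gauss (n + k)%N%:Z k.+1%:Z * gauss_den k.+1 = (1 - 'X^n) * gauss_num n k.
Proof.
case: n => [|n].
  by rewrite gauss_small ?ltz_nat ?add0n // expr0 subrr !mul0r.
rewrite addSnnS gaussE /gauss_num big_add1 [in RHS]big_add1 /=.
rewrite big_nat_recl // addn1; congr (_ * _).
by apply: eq_bigr => v _; rewrite addSnnS.
Qed.

(* Pascal's rule for [n - e + 1, k + 1], multiplied by q^(e + k) so that the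
   exponents stay nonnegative also when n < e or n - e < k. *)
Lemma gauss_pascal (n e k : nat) :
  'X^(e + k) * (gauss (n%:Z - e%:Z + 1) (k%:Z + 1) - gauss (n%:Z - e%:Z) (k%:Z + 1))
  = 'X^n * gauss (n%:Z - e%:Z) k%:Z.
Proof.
have [lt_n|le_n] := ltnP n (e + k).
  by rewrite !gauss_small ?subrr ?mulr0 //; lia.
have [p ->] : exists p, n = (e + (p + k))%N by exists (n - (e + k))%N; lia.
have -> : (e + (p + k))%N%:Z - e%:Z = (p + k)%N%:Z by lia.
have -> : (p + k)%N%:Z + 1 = (p + k.+1)%N%:Z by lia.
have -> : k%:Z + 1 = k.+1%:Z by lia.
apply: (mulIf (gauss_den_neq0 k.+1)).
have numS : gauss_num p k.+1 = gauss_num p k * (1 - 'X^(p + k.+1)).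
  by rewrite /gauss_num big_nat_recr.
have denS : gauss_den k.+1 = gauss_den k * (1 - 'X^(k.+1)).
  by rewrite /gauss_den big_nat_recr.
rewrite -mulrA mulrBl gaussE gauss_predE numS.
rewrite denS -mulrA [gauss _ _ * _]mulrA gaussE !exprD; ring.
Qed.

(** * Recurrences and special values of the one-boundary polynomial *)

Lemma Phi_term0 a b e : (b <= a + e)%N -> Phi_term a b e 0 = 1.
Proof.
move=> le_b; rewrite /Phi_term !gauss_n0 // [gauss _ (0 - 1)]gauss_neg //.
by rewrite mulr0 subr0 !mulr1.
Qed.

Lemma Phi_term_0l b e nu : (b <= e)%N -> Phi_term 0 b e nu.+1 = 0.
Proof.
move=> le_be; rewrite /Phi_term gauss_small ?ltz_nat // mul0r.
by rewrite [gauss (b%:Z - _ + _) _]gauss_small ?mulr0 ?mul0r ?subr0 ?mulr0 //; lia.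
Qed.

Lemma Phi_term_n0 a e nu : Phi_term a 0 e nu.+1 = 0.
Proof. by rewrite Phi_term_eq0. Qed.

(** For nu = k + 1, Pascal's rule makes both the first products and the second ones differ by a
    multiple of [a, k+1][b, k]. The powers of q agree because a + e = b + 1. *)
Lemma Phi_term_boundary a b e nu :
  (a + e)%N = b.+1 -> Phi_term a b.+1 e nu = Phi_term a b e nu.
Proof.
move=> Dab; case: nu => [|k]; first by rewrite !Phi_term0 //; lia.
have := gauss_pascal b 0 k; have := gauss_pascal a 0 k.+1.
rewrite /Phi_term !subr0 !add0n.
have -> : b.+1%:Z - e%:Z + 1 = a%:Z + 1 by lia.
have -> : b%:Z - e%:Z + 1 = a%:Z by lia.
have -> : a%:Z + e%:Z - 1 = b%:Z by lia.
have -> : k.+1%:Z - 1 = k%:Z by lia.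
have -> : b.+1%:Z = b%:Z + 1 by lia.
have -> : k%:Z + 1 = k.+1%:Z by lia.
(* The factor q^(k+1) supplies the powers on the left of both instances of [gauss_pascal]. *)
move=> Ea Eb; apply: (@mulfI _ 'X^(k.+1)); first exact: monic_neq0 (monicXn _ _).
apply/eqP; rewrite -subr_eq0; apply/eqP.
transitivity ('X^(k.+1 ^ 2) * ('X * gauss a k.+1 *
    ('X^k * (gauss (b%:Z + 1) k.+1 - gauss b k.+1))
  - 'X^e * gauss b k * ('X^(k.+1) * (gauss (a%:Z + 1) (k.+1%:Z + 1)
                                   - gauss a (k.+1%:Z + 1)))) : {poly rat}).
  by rewrite exprS; ring.
rewrite Ea Eb.
transitivity ('X^(k.+1 ^ 2) * gauss a k.+1 * gauss b k
  * ('X * 'X^b - 'X^e * 'X^a) : {poly rat}); first by ring.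
by rewrite -exprS -exprD addnC Dab subrr mulr0.
Qed.

(** Each product in [Phi_term] is a function of a times a function of b, so its mixed second
    difference is a product of two first differences ([E1], [E2]). Pascal's rule lowers both lower
    indices by one, and the powers of q combine since (nu+1)^2 - 2 nu = nu^2 + 1. *)
Lemma Phi_term_pascal a b e nu : (b < a + e)%N ->
  Phi_term a.+1 b.+1 e nu.+1 =
    Phi_term a b.+1 e nu.+1 + Phi_term a.+1 b e nu.+1 - Phi_term a b e nu.+1
    + 'X^((a + b).+1) * Phi_term a b e nu.
Proof.
move=> lt_b.
have Xn_neq0 n : 'X^n != 0 :> {poly rat} by apply: monic_neq0 (monicXn _ _).
pose D (M N : int) k := gauss M k - gauss N k.
have E1 : 'X^(nu.+1 ^ 2) * D a.+1 a nu.+1 * D b.+1 b nu.+1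
    = 'X^((a + b).+1 + nu ^ 2) * gauss a nu * gauss b nu.
  have := gauss_pascal a 0 nu; have := gauss_pascal b 0 nu.
  rewrite !subr0 !add0n.
  have -> : a%:Z + 1 = a.+1%:Z by lia.
  have -> : b%:Z + 1 = b.+1%:Z by lia.
  have -> : nu%:Z + 1 = nu.+1%:Z by lia.
  rewrite -!/(D _ _ _) => Eb Ea; apply: (mulfI (Xn_neq0 (nu + nu)%N)).
  transitivity ('X^(nu.+1 ^ 2) * ('X^nu * D a.+1 a nu.+1)
    * ('X^nu * D b.+1 b nu.+1)); first by rewrite exprD; ring.
  rewrite Ea Eb.
  transitivity ('X^(nu.+1 ^ 2 + a + b) * gauss a nu * gauss b nu).
    by rewrite !exprD; ring.
  by rewrite !mulrA -exprD; congr ('X^_ * _ * _); lia.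
have E2 : 'X^(nu.+1 ^ 2) * D (b.+1%:Z - e%:Z + 1) (b%:Z - e%:Z + 1) (nu.+1%:Z + 1)
      * D (a.+1%:Z + e%:Z - 1) (a%:Z + e%:Z - 1) (nu.+1%:Z - 1)
    = 'X^((a + b).+1 + nu ^ 2) * gauss (b%:Z - e%:Z + 1) (nu%:Z + 1)
      * gauss (a%:Z + e%:Z - 1) (nu%:Z - 1).
  (* For nu = 0 both sides vanish: the left has a difference 1 - 1 of binomials with lower index 0,
     as a + e > 0, and the right has lower index -1. *)
  case: nu {E1} => [|k].
    by rewrite /D !gauss_n0 ?subrr ?(@gauss_neg _ (0 - 1)) ?mulr0 //; lia.
  have [p Dp] : exists p, (a + e)%N = p.+1 by exists (a + e).-1; lia.
  have := gauss_pascal b.+1 e k.+2; have := gauss_pascal p 0 k.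
  rewrite !subr0 !add0n.
  have -> : a.+1%:Z + e%:Z - 1 = p%:Z + 1 by lia.
  have -> : a%:Z + e%:Z - 1 = p%:Z by lia.
  have -> : b.+1%:Z - e%:Z = b%:Z - e%:Z + 1 by lia.
  have -> : k.+2%:Z - 1 = k.+1%:Z by lia.
  have -> : k.+1%:Z - 1 = k%:Z by lia.
  have -> : k.+1%:Z + 1 = k.+2%:Z by lia.
  have -> : k%:Z + 1 = k.+1%:Z by lia.
  rewrite -!/(D _ _ _) => Ep Eb; apply: (mulfI (Xn_neq0 (e + k.+2 + k)%N)).
  transitivity ('X^(k.+2 ^ 2) *
      ('X^(e + k.+2) * D (b%:Z - e%:Z + 1 + 1) (b%:Z - e%:Z + 1) (k.+2%:Z + 1))
    * ('X^k * D (p%:Z + 1) p k.+1)); first by rewrite (exprD _ _ k); ring.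
  rewrite Ep Eb.
  transitivity ('X^(k.+2 ^ 2 + b.+1 + p) * gauss (b%:Z - e%:Z + 1) k.+2
    * gauss p k); first by rewrite !exprD; ring.
  by rewrite !mulrA -exprD; congr ('X^_ * _ * _); lia.
apply/eqP; rewrite -subr_eq0; apply/eqP.
transitivity (('X^(nu.+1 ^ 2) * D a.+1 a nu.+1 * D b.+1 b nu.+1
    - 'X^((a + b).+1 + nu ^ 2) * gauss a nu * gauss b nu)
  - 'X^e * ('X^(nu.+1 ^ 2)
      * D (b.+1%:Z - e%:Z + 1) (b%:Z - e%:Z + 1) (nu.+1%:Z + 1)
      * D (a.+1%:Z + e%:Z - 1) (a%:Z + e%:Z - 1) (nu.+1%:Z - 1)
    - 'X^((a + b).+1 + nu ^ 2) * gauss (b%:Z - e%:Z + 1) (nu%:Z + 1)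
      * gauss (a%:Z + e%:Z - 1) (nu%:Z - 1))).
  by rewrite /D /Phi_term exprD; ring.
by rewrite E1 E2 !subrr mulr0 subr0.
Qed.

Lemma coef_Phi a b e nu : (Phi a b e)`_nu = Phi_term a b e nu.
Proof.
rewrite /Phi big_mkord -(poly_def _ (Phi_term a b e)) coef_poly ltnS.
by case: leqP => // /Phi_term_eq0 ->.
Qed.

Lemma Phi_0l b e : (b <= e)%N -> Phi 0 b e = 1.
Proof.
move=> le_be; apply/polyP => -[|nu]; rewrite coef_Phi coef1.
  by rewrite Phi_term0.
by rewrite Phi_term_0l.
Qed.

Lemma Phi_n0 a e : Phi a 0 e = 1.
Proof.
apply/polyP => -[|nu]; rewrite coef_Phi coef1; first by rewrite Phi_term0.
by rewrite Phi_term_n0.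
Qed.

Lemma Phi_boundary a b e : (a + e)%N = b.+1 -> Phi a b.+1 e = Phi a b e.
Proof.
by move=> Dab; apply/polyP => nu; rewrite !coef_Phi Phi_term_boundary.
Qed.

Lemma Phi_pascal a b e : (b < a + e)%N ->
  Phi a.+1 b.+1 e =
    Phi a b.+1 e + Phi a.+1 b e - Phi a b e * (1 - 'X^((a + b).+1) *: 'X).
Proof.
move=> lt_b; apply/polyP => nu.
rewrite mulrBr mulr1 -scalerAr opprB addrA addrAC.
rewrite !(coefB, coefD) coefZ coefMX !coef_Phi.
case: nu => [|nu] /=; last by rewrite Phi_term_pascal //; ring.
by rewrite !Phi_term0 ?mulr0 //; lia || ring.
Qed.

(** Induction on a, then on b. The last case is separate because there (a, b + 1) lies outside the
    region. *)
Lemma trapezoid_region_ind (e : nat) (Q : nat -> nat -> Prop) :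
    (forall a, Q a 0) -> (forall b, (b <= e)%N -> Q 0 b) ->
    (forall a b, (b < a + e)%N ->
       Q a b.+1 -> Q a.+1 b -> Q a b -> Q a.+1 b.+1) ->
    (forall a b, (a + e)%N = b -> Q a.+1 b -> Q a.+1 b.+1) ->
  forall a b, (b <= a + e)%N -> Q a b.
Proof.
move=> Qn0 Q0l Qin Qbd; elim=> [|a IHa] b; first exact: Q0l.
elim: b => [|b IHb] le_b //.
have := le_b; rewrite addSn ltnS leq_eqVlt => /predU1P[Dab|lt_b].
  by apply: Qbd; [rewrite Dab|apply: IHb; lia].
by apply: Qin => //; [apply: IHa | apply: IHb | apply: IHa]; lia.
Qed.

Lemma Phi_at1 a b e : (b <= a + e)%N ->
  (Phi a b e).[1].[1] = 'C(a + b, a)%:R - 'C(a + b, a + e + 1)%:R.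
Proof.
move: a b; apply: trapezoid_region_ind => [a|b le_b|a b lt_b|a b Dab].
- by rewrite Phi_n0 !hornerE binn bin_small ?subr0 //; lia.
- by rewrite Phi_0l // !hornerE bin0 bin_small ?subr0 //; lia.
- rewrite Phi_pascal // => IH1 IH2 _.
  (* At q = t = 1 the factor 1 - q^(a+b+1) t kills the third term. *)
  rewrite !hornerE IH1 IH2 expr1n subrr mulr0 subr0.
  have binDS m : 'C(a.+1 + b.+1, m.+1)%:R
      = 'C(a.+1 + b, m.+1)%:R + 'C(a + b.+1, m)%:R :> rat.
    by rewrite addnS binS addSnnS natrD.
  rewrite !addn1 [(a.+1 + e)%N]addSn !binDS.
  by rewrite addrC addrACA -opprD.
- rewrite Phi_boundary; last by lia.
  move=> ->.
  have binDS m : 'C(a.+1 + b.+1, m.+1)%:R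
      = 'C(a.+1 + b, m.+1)%:R + 'C(a.+1 + b, m)%:R :> rat.
    by rewrite addnS binS natrD.
  rewrite !addn1 [(a.+1 + e)%N]addSn !binDS.
  (* Reflection: since b = a + e, the two lower indices add up to a + 1 + b. *)
  suff -> : 'C(a.+1 + b, a) = 'C(a.+1 + b, (a + e).+1).
    by rewrite opprD addrACA subrr addr0.
  by rewrite -bin_sub; [congr 'C(_, _)|]; lia.
Qed.

(** * Formal power series in t *)

Section PowerSeries.
Variable R : comNzRingType.
Implicit Types (p : {poly R}) (f : nat -> R).

(** A series is its coefficient sequence: [delay] multiplies it by t and [conv p] by the polynomial
    p. *)
Definition delay f (m : nat) : R := if m is m'.+1 then f m' else 0.

Definition conv p f (m : nat) : R := \sum_(k < m.+1) p`_k * f (m - k)%N.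

Lemma eq_conv p f g : f =1 g -> conv p f =1 conv p g.
Proof. by move=> eq_fg m; apply: eq_bigr => k _; rewrite eq_fg. Qed.

Lemma convD p f g m : conv p (fun i => f i + g i) m = conv p f m + conv p g m.
Proof. by rewrite -big_split; apply: eq_bigr => k _; rewrite mulrDr. Qed.

Lemma convB p f g m : conv p (fun i => f i - g i) m = conv p f m - conv p g m.
Proof. by rewrite -sumrB; apply: eq_bigr => k _; rewrite mulrBr. Qed.

Lemma conv1 f m : conv 1 f m = f m.
Proof.
rewrite /conv big_ord_recl coef1 mul1r subn0 big1 ?addr0 // => k _.
by rewrite coef1 mul0r.
Qed.

Lemma conv_mul1B_delay p c f m :
  conv (p * (1 - c *: 'X)) f m = conv p f m - c * delay (conv p f) m.
Proof.
have coefE k : (p * (1 - c *: 'X))`_k = p`_k - c * delay (nth 0 p) k.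
  by rewrite mulrBr mulr1 -scalerAr coefB coefZ coefMX; case: k.
rewrite /conv; under eq_bigr do rewrite coefE mulrBl.
rewrite sumrB; congr (_ - _); rewrite big_ord_recl /= mulr0 mul0r add0r.
case: m => [|m] /=; first by rewrite big_ord0 mulr0.
by rewrite mulr_sumr; apply: eq_bigr => k _; rewrite mulrA.
Qed.

(** Associativity of the product: a factor 1 - c t passes from the polynomial to the series. *)
Lemma conv_delay p c f m :
  conv p (fun i => f i - c * delay f i) m = conv (p * (1 - c *: 'X)) f m.
Proof.
rewrite conv_mul1B_delay convB; congr (_ - _).
rewrite /conv big_ord_recr subnn /= mulr0 mulr0 addr0.
case: m => [|m] /=; first by rewrite big_ord0 mulr0.
rewrite mulr_sumr; apply: eq_bigr => k _.
by rewrite subSn ?leq_ord // mulrCA.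
Qed.

End PowerSeries.

(** * Multichains in the planar region *)

Section ChainSeries.
Variable e : nat.

(* The number of multichains of size m in the region j <= i + e below (a, b),
   counted with weight q^(sum of ranks), by recursion on the largest element. *)
Fixpoint chain_series (a b m : nat) : {poly rat} :=
  if m is m'.+1 then
    \sum_(i < a.+1) \sum_(j < b.+1 | (j <= i + e)%N)
      'X^(i + j) * chain_series i j m'
  else 1.

Lemma chain_series00 m :
  chain_series 0 0 m - 'X^0 * delay (chain_series 0 0) m = (m == 0)%:R.
Proof.
case: m => [|m] /=; first by rewrite mulr0 subr0.
by rewrite big_ord1 big_mkcond big_ord1 /= addn0 subrr.
Qed.

Lemma chain_series_n0 a m :
  chain_series a.+1 0 m - 'X^(a.+1) * delay (chain_series a.+1 0) m
  = chain_series a 0 m.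
Proof.
case: m => [|m] /=; first by rewrite mulr0 subr0.
have row0 i : \sum_(j < 1 | (j <= i + e)%N) 'X^(i + j) * chain_series i j m
    = 'X^i * chain_series i 0 m by rewrite big_mkcond big_ord1 /= addn0.
by rewrite big_ord_recr /= row0 addrK.
Qed.

(** The first hypothesis says that (a, b + 1) is the only point with second coordinate b + 1. This
    covers both a = 0 and the boundary b + 1 = a + e. *)
Lemma chain_series_top_row a b m :
    (forall i, (i < a)%N -> (i + e < b.+1)%N) -> (b.+1 <= a + e)%N ->
  chain_series a b.+1 m - 'X^(a + b.+1) * delay (chain_series a b.+1) m
  = chain_series a b m.
Proof.
move=> out_row le_b; case: m => [|m] /=; first by rewrite mulr0 subr0.
rewrite big_ord_recr [in RHS]big_ord_recr /=.
under eq_bigr => i _ do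
  rewrite big_mkcond big_ord_recr /= leqNgt out_row //= addr0 -big_mkcond /=.
rewrite -addrA; congr (_ + _).
by rewrite big_mkcond big_ord_recr /= le_b addrK -big_mkcond.
Qed.

Lemma chain_series_inner a b m : (b < a + e)%N ->
  chain_series a.+1 b.+1 m
    - 'X^((a + b).+2) * delay (chain_series a.+1 b.+1) m
  = chain_series a b.+1 m + chain_series a.+1 b m - chain_series a b m.
Proof.
move=> lt_b; case: m => [|m] /=; first by rewrite mulr0 subr0 addrK.
pose row b' i := \sum_(j < b'.+1 | (j <= i + e)%N) 'X^(i + j) * chain_series i j m.
rewrite -!/(row _ _) !big_ord_recr /= -!/(row _ _).
have -> : row b.+1 a.+1 = row b a.+1 + 'X^((a + b).+2) * chain_series a.+1 b.+1 m.
  rewrite /row big_mkcond big_ord_recr /= ifT; last by lia.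
  by rewrite -big_mkcond addSn addnS.
ring.
Qed.

(** Indexed by the number of factors, so that they can be peeled off one at a time. *)
Definition zeta_denominator n : {poly {poly rat}} :=
  \prod_(0 <= k < n) (1 - 'X^k *: 'X).

Lemma conv_denominatorS n f m :
  conv (zeta_denominator n.+1) f m
  = conv (zeta_denominator n) (fun i => f i - 'X^n * delay f i) m.
Proof. by rewrite conv_delay /zeta_denominator big_nat_recr. Qed.

Lemma chain_series_numerator a b m : (b <= a + e)%N ->
  conv (zeta_denominator (a + b).+1) (chain_series a b) m = (Phi a b e)`_m.
Proof.
move=> le_b; move: a b le_b m.
have num00 m : conv (zeta_denominator 1) (chain_series 0 0) m = (Phi 0 0 e)`_m.
  rewrite conv_denominatorS /zeta_denominator big_nil conv1 chain_series00.
  by rewrite Phi_n0 coef1.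
apply: trapezoid_region_ind => [a|b le_b|a b lt_b IH1 IH2 IH3|a b Dab IH] m.
- elim: a m => // a IHa m; rewrite addn0 conv_denominatorS.
  by rewrite (eq_conv _ (chain_series_n0 a)) -[a.+1]addn0 addSn IHa !Phi_n0.
- elim: b le_b m => // b IHb le_b m; rewrite add0n conv_denominatorS.
  have row0 i : chain_series 0 b.+1 i - 'X^(b.+1) * delay (chain_series 0 b.+1) i
      = chain_series 0 b i by apply: chain_series_top_row.
  by rewrite (eq_conv _ row0) IHb ?Phi_0l // ltnW.
- rewrite addnS in IH1; rewrite addSn in IH2.
  rewrite addSn addnS conv_denominatorS.
  rewrite (eq_conv _ (fun i => chain_series_inner i lt_b)) convB convD IH1 IH2.
  (* The numerator at (a, b) takes one denominator factor fewer; the surplus one is the factor 1 -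
     q^(a+b+1) t of [Phi_pascal]. *)
  rewrite {1}/zeta_denominator big_nat_recr //= -/(zeta_denominator _).
  rewrite conv_mul1B_delay IH3 Phi_pascal // mulrBr mulr1 -scalerAr.
  rewrite !(coefB, coefD) coefZ coefMX; congr (_ - (_ - _ * _)).
  by case: m => //= m; rewrite IH3.
- have top_row i : chain_series a.+1 b.+1 i
      - 'X^(a.+1 + b.+1) * delay (chain_series a.+1 b.+1) i
      = chain_series a.+1 b i.
    by apply: chain_series_top_row => [k|]; lia.
  rewrite conv_denominatorS (eq_conv _ top_row) addnS IH.
  by rewrite Phi_boundary //; lia.
Qed.

End ChainSeries.

(** * Weak chains by largest element *)

Section ChainsBelow.
Variables (d : Order.disp_t) (P : finPOrderType d) (rho : P -> nat).

(** Chains are listed downwards, with z only a bound, so that removing the head gives the recursion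
    of [chain_series]. *)
Definition chains_below (m : nat) (z : P) : {poly rat} :=
  \sum_(c : m.-tuple P | path >=%O z c) 'X^(\sum_(w <- c) rho w).

Lemma chains_below0 z : chains_below 0 z = 1.
Proof.
rewrite /chains_below (big_pred1 [tuple]) ?big_nil // => c.
by rewrite (tuple0 c) [RHS]eqxx.
Qed.

Lemma chains_belowS m z :
  chains_below m.+1 z = \sum_(w | (w <= z)%O) 'X^(rho w) * chains_below m w.
Proof.
under [RHS]eq_bigr do rewrite big_distrr /=.
rewrite pair_big_dep /=.
rewrite /chains_below.
rewrite (reindex (fun p : P * m.-tuple P => [tuple of p.1 :: p.2])) /=.
  by apply: eq_bigr => p _; rewrite big_cons exprD.
exists (fun c => (thead c, [tuple of behead c])) => [[w c] _ | c _].
  by congr pair; apply: val_inj.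
by rewrite -tuple_eta.
Qed.

(** Reversal makes chains decreasing and keeps their weight; the maximum bounds all of them. *)
Lemma qzeta_chains_below m y :
  (forall z, z <= y)%O -> qzeta rho m = chains_below m y.
Proof.
move=> y_max; have revtK : involutive (fun c : m.-tuple P => [tuple of rev c]).
  by move=> c; apply: val_inj; rewrite /= revK.
rewrite /qzeta /chains_below (reindex_inj (inv_inj revtK)) /=.
apply: eq_big => [c|c _].
  rewrite /weak_chain /= rev_sorted; case: (tval c) => //= w c'.
  by rewrite y_max.
by rewrite (perm_big c) //= perm_rev.
Qed.

End ChainsBelow.

(** * Intervals of the trapezoid as planar regions *)

Section TrapezoidInterval.
Variables (r s : nat) (x y : trapezoid r s).
Hypothesis le_xy : (x <= y)%O.
Local Notation I := (poset_interval x y).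
Local Notation e := (s - trap_row x - trap_col x)%N.
Local Notation rho := (interval_rank (x := x) (y := y) (@trap_rank r s)).

(** With [shift], coordinates with origin x: on the interval the order is componentwise, the rank is
    the sum, and c <= s - i becomes [shift <= depth + e]. *)
Definition depth (z : trapezoid r s) : nat := trap_row x - trap_row z.
Definition shift (z : trapezoid r s) : nat := trap_col z - trap_col x.

Lemma trapezoidP (z : trapezoid r s) :
  (0 < trap_row z <= r)%N && (trap_row z <= trap_col z <= s - trap_row z)%N.
Proof. by have /and4P[z1 z2 z3 z4] := valP z; apply/andP; split; apply/andP. Qed.

Lemma trap_leE (z w : trapezoid r s) :
  (z <= w)%O = (trap_row w <= trap_row z)%N && (trap_col z <= trap_col w)%N.
Proof. by []. Qed.

Lemma intervalP (z : I) : (x <= interval_val z <= y)%O.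
Proof. by case: z. Qed.

Lemma interval_le (z w : I) :
  (z <= w)%O = (depth (interval_val z) <= depth (interval_val w))%N
            && (shift (interval_val z) <= shift (interval_val w))%N.
Proof.
have := intervalP z; have := intervalP w.
rewrite -[LHS]/(interval_val z <= interval_val w)%O /depth /shift !trap_leE.
lia.
Qed.

Lemma interval_rankE (z : I) :
  rho z = (depth (interval_val z) + shift (interval_val z))%N.
Proof.
have := intervalP z; have := trapezoidP (interval_val z); have := trapezoidP x.
rewrite !trap_leE /rho /interval_rank /trap_rank /depth /shift; lia.
Qed.

Lemma interval_bounds (z : I) :
  (shift (interval_val z) <= depth (interval_val z) + e)%N.
Proof.
have := intervalP z; have := trapezoidP (interval_val z); have := trapezoidP x.
rewrite !trap_leE /depth /shift; lia.
Qed.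

(** The remaining trapezoid inequalities are inherited from x and y, since rows decrease and columns
    increase upwards. *)
Lemma interval_exists i j :
  (i <= depth y)%N -> (j <= shift y)%N -> (j <= i + e)%N ->
  exists z : I, depth (interval_val z) = i /\ shift (interval_val z) = j.
Proof.
move=> le_i le_j le_ij.
have := trapezoidP y; have := trapezoidP x; have := le_xy.
rewrite trap_leE => Hxy Hx Hy.
have lt_r : (trap_row x - i < r.+1)%N by lia.
have lt_s : (trap_col x + j < s.+1)%N by rewrite /shift in le_j; lia.
have zP : in_trapezoid (Ordinal lt_r, Ordinal lt_s).
  by rewrite /in_trapezoid /=; rewrite /shift /depth in le_i le_j; lia.
have xzy : (x <= Trapezoid zP <= y)%O.
  rewrite !trap_leE /trap_row /trap_col /=.
  by rewrite /shift /depth /trap_row /trap_col in le_i le_j Hxy Hx Hy *; lia.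
exists (PosetInterval xzy); rewrite /shift /depth.
rewrite /= /trap_row /trap_col /= -/(trap_row x) -/(trap_col x).
by rewrite /depth in le_i; lia.
Qed.

Lemma chains_below_interval m (z : I) :
  chains_below rho m z
  = chain_series e (depth (interval_val z)) (shift (interval_val z)) m.
Proof.
elim: m z => [|m IHm] z; first exact: chains_below0.
rewrite chains_belowS /=.
under eq_bigr => w _ do rewrite IHm interval_rankE.
set a := depth _; set b := shift _.
(* [inord] returns the true coordinates only for w <= z, the range where [h] is evaluated. *)
pose h (w : I) : 'I_a.+1 * 'I_b.+1 :=
  (inord (depth (interval_val w)), inord (shift (interval_val w))).
rewrite pair_big_dep /=.
have hE (w : I) : (w <= z)%O ->
    (h w).1 = depth (interval_val w) :> nat
    /\ (h w).2 = shift (interval_val w) :> nat.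
  by rewrite interval_le => /andP[? ?]; rewrite !inordK.
have h_inj : {in [set w | (w <= z)%O] &, injective h}.
  move=> v w; rewrite !inE => le_v le_w eq_h.
  have [v1 v2] := hE _ le_v; have [w1 w2] := hE _ le_w.
  rewrite eq_h in v1 v2.
  by apply: le_anti; rewrite !interval_le -v1 -v2 w1 w2 !leqnn.
have h_im (p : 'I_a.+1 * 'I_b.+1) :
    true && (p.2 <= p.1 + e)%N = (p \in h @: [set w | (w <= z)%O]).
  apply/idP/imsetP => [le_p | [w]].
    have := intervalP z; rewrite !trap_leE => le_z.
    have [] := @interval_exists p.1 p.2 _ _ le_p.
    - by have := ltn_ord p.1; rewrite /a /depth; lia.
    - by have := ltn_ord p.2; rewrite /b /shift; lia.
    move=> w [w1 w2]; have le_w : (w <= z)%O.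
      by rewrite interval_le w1 w2 !leq_ord.
    exists w; first by rewrite inE.
    by rewrite [LHS]surjective_pairing /h w1 w2 !inord_val.
  by rewrite inE => /hE[w1 w2] ->; rewrite w1 w2; apply: interval_bounds.
rewrite (eq_bigl _ _ h_im) big_imset //=.
apply: eq_big => [w | w /hE[/= -> ->] //].
by rewrite inE.
Qed.

Lemma max_rank_interval : max_rank rho = (depth y + shift y)%N.
Proof.
have yP : (x <= y <= y)%O by rewrite le_xy lexx.
apply/eqP; rewrite eqn_leq; apply/andP; split.
  apply/bigmax_leqP => z _; rewrite interval_rankE.
  by have := intervalP z; rewrite !trap_leE /depth /shift; lia.
by rewrite -(interval_rankE (PosetInterval yP)) /max_rank leq_bigmax.
Qed.

(** The defining identity prescribes every coefficient of N, which gives existence and uniqueness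
    together. *)
Lemma interval_numeratorP (N : {poly {poly rat}}) :
  is_qzeta_numerator rho N <-> N = Phi (depth y) (shift y) e.
Proof.
have yP : (x <= y <= y)%O by rewrite le_xy lexx.
pose top : I := PosetInterval yP.
have top_max (z : I) : (z <= top)%O by have /andP[] := intervalP z.
have coefE m : \sum_(k < m.+1) (qzeta_denominator rho)`_k * qzeta rho (m - k)
    = (Phi (depth y) (shift y) e)`_m.
  rewrite -chain_series_numerator; last exact: interval_bounds top.
  apply: eq_bigr => k _.
  rewrite (qzeta_chains_below _ _ top_max) chains_below_interval.
  by rewrite /qzeta_denominator max_rank_interval.
split=> [numN | ->]; last by move=> m; rewrite coefE.
by apply/polyP => m; rewrite numN coefE.
Qed.

End TrapezoidInterval.

Theorem theorem4p3 (r s : nat) (x y : trapezoid r s)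
    (hr : (2 <= 2 * r)%N) (hs : (2 * r <= s)%N) (hxy : (x <= y)%O) :
  let l := (trap_row x - trap_row y)%N in
  let u := (trap_col y - trap_col x)%N in
  let delta := (s - trap_row x - trap_col x)%N in
  let rho_xy := interval_rank (x := x) (y := y) (@trap_rank r s) in
  [/\ forall N : {poly {poly rat}},
        is_qzeta_numerator rho_xy N <-> N = Phi l u delta,
      forall N : {poly {poly rat}}, is_qzeta_numerator rho_xy N ->
        N.[1].[1] = 'C(l + u, l)%:R - 'C(l + u, l + delta + 1)%:R
    & forall (r' s' : nat) (x' y' : trapezoid r' s'),
        (2 <= 2 * r')%N -> (2 * r' <= s')%N -> (x' <= y')%O ->
        (trap_row x' - trap_row y')%N = l ->
        (trap_col y' - trap_col x')%N = u ->
        (s' - trap_row x' - trap_col x')%N = delta ->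
        forall N : {poly {poly rat}},
          is_qzeta_numerator
            (interval_rank (x := x') (y := y') (@trap_rank r' s')) N
          <-> is_qzeta_numerator rho_xy N].
Proof.
move=> l u delta rho_xy.
have numP := interval_numeratorP hxy; split=> //.
  move=> N /numP ->; apply: Phi_at1.
  (* [Phi_at1] needs u <= l + delta, the region bound at y. *)
  have yP : (x <= y <= y)%O by rewrite hxy lexx.
  exact: interval_bounds (PosetInterval yP).
move=> r' s' x' y' _ _ hxy' Dl Du Dd N.
rewrite (interval_numeratorP hxy') /depth /shift Dl Du Dd.
by apply: iff_sym; apply: numP.
Qed.
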